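(* Let $x$ be an irrational real number with Hurwitz partial quotients $(a_n)_{n\geq0}$, and fix $0<\delta\leq 1/3$. For each $\rho>0$ let $$X_\rho = \frac{\#\{(p,q)\in\mathbb{Z}^2 \text{ primitive} : 0<q\leq\rho,\ |q(qx-p)|\leq\delta\}}{\log\rho}.$$ Let $\phi=(1+\sqrt5)/2$. Then $$\liminf_{\rho\to\infty} X_\rho \geq \liminf_{n\to\infty}\frac{\#\{j=1,\ldots,n : |a_{j+1}|\geq \delta^{-1}+(2.5-\phi)\}}{\sum_{j=1}^n \log(|a_j|+(\phi-1))},$$ and $$\limsup_{\rho\to\infty} X_\rho \leq \limsup_{n\to\infty}\frac{\#\{j=1,\ldots,n : |a_{j+1}|\geq \delta^{-1}-(\phi-0.5)\}}{\sum_{j=1}^n \log(|a_j|-(2-\phi))}.$$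
   Context: Hurwitz algorithm for an irrational real $x$: set $x_0=x$. Given $x_n$, let $a_n$ be the integer nearest to $x_n$ (ties rounded down), and set $x_{n+1}=1/(x_n-a_n)$. The integers $a_n$ are the Hurwitz partial quotients. A pair $(p,q)\in\mathbb{Z}^2$ is primitive if $\gcd(p,q)=1$. *)

(* Defs.v *)
From mathcomp Require Import all_boot all_order all_algebra finmap.
From mathcomp Require Import all_classical all_reals all_analysis.
From mathcomp Require Import lra zify.

Set Implicit Arguments.
Unset Strict Implicit.
Unset Printing Implicit Defensive.
Import Order.TTheory GRing.Theory Num.Theory.
Import numFieldNormedType.Exports.
Local Open Scope classical_set_scope.
Local Open Scope ring_scope.

Section Hurwitz.
Variable R : realType.
Implicit Types (x y delta rho c d : R) (a : nat -> int) (n : nat).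

(* Nearest integer, ties rounded down. *)
Definition nearest_int y : int :=
  if y - (Num.floor y)%:~R <= 2^-1 then Num.floor y else Num.floor y + 1.

Lemma nearest_intP y (b : int) :
  `|y - (nearest_int y)%:~R| <= `|y - b%:~R| /\
  (`|y - (nearest_int y)%:~R| = `|y - b%:~R| -> nearest_int y <= b).
Proof.
have l1 := Num.Theory.floor_le y.
have l2 : y < (Num.floor y)%:~R + 1 by rewrite -[1]/(1%:~R) -intrD floorD1_gt.
rewrite /nearest_int; move: (Num.floor y) l1 l2 => m l1 l2.
have [bm|mb] := leP b m.
- have bm' : b%:~R <= m%:~R :> R by rewrite ler_int.
  case: (leP (y - m%:~R)) => h.
  + split=> [|e]; first by rewrite !ger0_norm; lra.
    suff: m%:~R <= b%:~R :> R by rewrite ler_int.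
    by move: e; rewrite !ger0_norm; lra.
  + rewrite intrD ler0_norm ?ger0_norm; [|lra..].
    by split=> [|e]; [lra|exfalso; lra].
- have mb' : m%:~R + 1 <= b%:~R :> R.
    by rewrite -[1]/(1%:~R) -intrD ler_int; lia.
  split; last by move=> _; case: ifP => _; lia.
  case: (leP (y - m%:~R)) => h.
  + by rewrite ger0_norm ?ler0_norm; lra.
  + by rewrite intrD !ler0_norm; lra.
Qed.

Definition hurwitz_x x n : R :=
  iter n (fun y => (y - (nearest_int y)%:~R)^-1) x.

Definition hurwitz_a x n : int := nearest_int (hurwitz_x x n).

Definition golden_ratio : R := (1 + Num.sqrt 5) / 2.

Definition approximations x delta rho : set (int * int) :=
  [set pq | [/\ gcdz pq.1 pq.2 = 1,
                0 < pq.2, pq.2%:~R <= rho &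
                `|pq.2%:~R * (pq.2%:~R * x - pq.1%:~R)| <= delta]].

(* [fset_set] is the empty set on infinite sets: this excludes that case. *)
Lemma finite_approximations x delta rho :
  finite_set (approximations x delta rho).
Proof.
pose B := (Num.truncn (`|rho| * `|x| + `|delta| + `|rho|)).+1.
have hB : `|rho| * `|x| + `|delta| + `|rho| < B%:R by exact: truncnS_gt.
apply: (@sub_finite_set _ _ ((fun ij : nat * nat =>
    (ij.1%:Z - B%:Z, ij.2%:Z - B%:Z)) @` (`I_(B.*2) `*` `I_(B.*2)))); last first.
  by apply: finite_image; apply: finite_setX; exact: finite_II.
move=> [p q] [/= _ q0 qrho pqd].
have q1 : 1 <= q%:~R :> R by rewrite -[1]/(1%:~R) ler_int; lia.
have rho0 : `|rho| = rho by rewrite ger0_norm; lra.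
have qx : `|q%:~R * x| <= rho * `|x|.
  by rewrite normrM ger0_norm; [apply: ler_wpM2r | lra].
have qxp : `|q%:~R * x - p%:~R| <= `|delta|.
  apply: le_trans (ler_norm _); apply: le_trans pqd.
  by rewrite normrM ler_peMl// ger0_norm; lra.
have x0 : 0 <= rho * `|x| by apply: mulr_ge0 => //; lra.
have d0 := normr_ge0 delta.
have px : `|p%:~R| < B%:~R :> R.
  move: hB qx qxp; rewrite rho0 !ler_norml ltr_norml -!pmulrn.
  move=> hB /andP[? ?] /andP[? ?].
  by apply/andP; split; lra.
have qB : q%:~R < B%:~R :> R by move: hB; rewrite rho0 -!pmulrn; lra.
move: px qB; rewrite -intr_norm !ltr_int => px qB.
exists (`|(p + B%:Z)%R|%N, `|(q + B%:Z)%R|%N) => /=; first by split => /=; lia.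
by congr pair; lia.
Qed.

Definition approximation_ratio x delta rho : R :=
  #|` fset_set (approximations x delta rho)|%:R / ln rho.

Definition quotient_ratio a c d n : R :=
  (count (fun j => c <= `|a j.+1|%:~R) (iota 1 n))%:R /
  \sum_(1 <= j < n.+1) ln (`|a j|%:~R + d).

End Hurwitz.

Arguments golden_ratio {R}.

(* Main.v *)
Require Import Defs.
From mathcomp Require Import all_boot all_order all_algebra finmap.
From mathcomp Require Import all_classical all_reals all_analysis.
From mathcomp Require Import ring lra zify.
Import Order.TTheory GRing.Theory Num.Theory.
Import numFieldNormedType.Exports.
Local Open Scope classical_set_scope.
Local Open Scope ring_scope.

(**
Write [phi] for the golden ratio, [p_n / q_n] for the convergents of the Hurwitz
expansion and [w_n = q_(n-1) / q_n]. Since [|a_n| = 2] forces [a_(n+1)] to have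
the sign of [a_n], induction gives [-(2 - phi) <= sg(a_(n+1)) w_n <= phi - 1].
Hence [|q_(n+1) / q_n| = |a_(n+1) + w_n|] lies between [|a_(n+1)| - (2 - phi)]
and [|a_(n+1)| + (phi - 1)], which compares [ln |q_n|] with the two sums of
logarithms, and [|q_n (q_n x - p_n)| = 1 / |x_(n+1) + w_n|] compares the
condition on the convergent with the two conditions on [|a_(n+1)|].

Moreover every primitive [(p, q)] with [q |q x - p| <= 1 / 3] is, up to sign, a
convergent. Choose [n] with [|q_n| <= q < |q_(n+1)|] and write
[(p, q) = u (p_n, q_n) + k (p_(n+1), q_(n+1))] with integers [u] and [k]; with
[w = w_(n+1)] and [X = x_(n+2)],
  [q (q x - p) = +-(k + u w) (k - u X) / (X + w)],
which exceeds [1 / 3] in absolute value as soon as [k <> 0]. So the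
approximations counted at [rho] are the good convergents with [|q_n| <= rho],
and the ratios differ from the bounds only by one term over a sum of logarithms
that grows at least linearly.
*)

(** * Upper and lower limits along a sequence and along a real parameter *)

(** Transfers a pointwise comparison, at an index depending on [r] and arbitrarily large, to the
    upper limits. The null sequence [e] absorbs the miscounted term. *)
Lemma limf_esup_le_limn_esup (R : realType) (f : R -> R) (u e : nat -> R) :
  e n @[n --> \oo] --> 0 ->
  (forall N, \forall r \near +oo, exists2 n, (N <= n)%N & f r <= u n + e n) ->
  (limf_esup (fun r => (f r)%:E) (pinfty_nbhs R)
    <= limn_esup (fun n => (u n)%:E))%E.
Proof.
move=> e0 fu; apply: le_ereal_inf_tmp => _ [V [N _ NV] <-].
apply/lee_addgt0Pr => eps eps0.
have /cvgrPdist_lt/(_ _ eps0)[N' _ e_lt] := e0.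
(* The comparison holds on a neighbourhood of infinity, so the supremum of [f] over it bounds the
   upper limit. *)
apply: (@le_trans _ _ (ereal_sup ((fun r => (f r)%:E) @`
    [set r | exists2 n, (maxn N N' <= n)%N & f r <= u n + e n]))).
  apply: ereal_inf_lbound; eexists; last by reflexivity.
  exact: fu.
apply: ge_ereal_sup => _ [r /= [n + fr] <-]; rewrite geq_max => /andP[Nn N'n].
apply: (@le_trans _ _ (u n + eps)%:E).
  rewrite lee_fin (le_trans fr)// lerD2l.
  have := e_lt n N'n; rewrite sub0r normrN => /ltW.
  exact: le_trans (ler_norm _).
rewrite EFinD leeD2r//; apply: ereal_sup_ubound.
by exists n => //; exact: NV.
Qed.

Lemma limn_einf_le_limf_einf (R : realType) (f : R -> R) (u e : nat -> R) :
  e n @[n --> \oo] --> 0 ->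
  (forall N, \forall r \near +oo, exists2 n, (N <= n)%N & u n <= f r + e n) ->
  (limn_einf (fun n => (u n)%:E)
    <= limf_einf (fun r => (f r)%:E) (pinfty_nbhs R))%E.
Proof.
move=> e0 fu; rewrite leeN2.
apply: (@limf_esup_le_limn_esup _ (\- f) (\- u) e) => // N.
apply: filterS (fu N) => r [n Nn uf]; exists n => //=; lra.
Qed.

(** * Lower bounds for pairs that are not convergents *)

(* This and the next lemma bound [(k + u w) (k - u X)] for [w > 0] (where [u] and
   [k] have opposite signs) and for [w = - s < 0] (same signs). *)
Lemma opposite_side_bound (R : realFieldType) (w X U V : R) :
  2 <= X -> 0 < w <= 31 / 50 -> (U = 1 \/ 2 <= U) -> (V = 1 \/ 2 <= V) ->
  w <= `|V - U * w| < 1 -> X + w < 3 * (`|V - U * w| * (V + U * X)).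
Proof.
move=> X2 /andP[w0 w1] U12 V12 /andP[wl l1].
have [U1 V1] : 1 <= U /\ 1 <= V by split; lra.
have X0 : 0 <= X by lra.
have [UwV UX] : V - 1 < U * w /\ X <= U * X.
  by split; [move: l1; rewrite ltr_norml => /andP[]; lra|rewrite ler_peMl].
(* The first factor is at least [w]. This suffices when [U * w >= 1 / 3]; otherwise [V - 1 < U * w]
   forces [V = 1]. *)
have lb : w + U * w * X <= `|V - U * w| * (V + U * X).
  apply: (@le_trans _ _ (w * (V + U * X))).
    have : w <= w * V by rewrite ler_peMr// ltW.
    lra.
  by apply: ler_wpM2r => //; lra.
have [h|h] := leP 3^-1 (U * w).
  have : 3^-1 * X <= U * w * X by apply: ler_wpM2r.
  lra.
have V_1 : V = 1 by lra.
rewrite V_1 in UwV wl l1 lb *.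
rewrite ger0_norm; last by lra.
case: U12 => [->|U2]; first by nra.
have : 2 / 3 * (1 + 2 * X) <= (1 - U * w) * (1 + U * X).
  by apply: ler_pM; [lra|lra|lra|rewrite lerD2l ler_wpM2r].
lra.
Qed.

Lemma same_side_bound (R : realFieldType) (s X U V : R) :
  2 <= X -> 0 < s <= 2 / 5 -> (U = 1 \/ 2 <= U) -> (V = 1 \/ 2 <= V) ->
  s <= `|V - U * s| < 1 -> X - s < 3 * (`|V - U * s| * (U * X - V)).
Proof.
move=> X2 /andP[s0 s1] U12 V12 /andP[sl l1].
have [U1 V1] : 1 <= U /\ 1 <= V by split; lra.
have X0 : 0 <= X by lra.
have UsV : V - 1 < U * s by move: l1; rewrite ltr_norml => /andP[]; lra.
have UX : X <= U * X by rewrite ler_peMl.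
have UX' : V * (5 / 2) <= U * X + 5 / 2.
  have : U * s <= U * (2 / 5) by apply: ler_wpM2l; lra.
  have : U * 2 <= U * X by apply: ler_wpM2l; lra.
  lra.
have UXV : 0 <= U * X - V by lra.
(* Again the first factor is bounded below by [s], which suffices when [V >= 2] or
   [U * s >= 1 / 2]. *)
have lb : U * s * X - V * s <= `|V - U * s| * (U * X - V).
  apply: (@le_trans _ _ (s * (U * X - V))); first by lra.
  by apply: ler_wpM2r.
case: V12 => [V_1|V2]; last first.
  have : (V - 1) * X <= U * s * X by apply: ler_wpM2r => //; lra.
  by nra.
rewrite V_1 in UsV sl l1 lb *.
have [h|h] := leP 2^-1 (U * s).
  have : 2^-1 * X <= U * s * X by apply: ler_wpM2r.
  lra.
rewrite ger0_norm; last by lra.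
case: U12 => [->|U2]; first by nra.
have : 2^-1 * (2 * X - 1) <= (1 - U * s) * (U * X - 1).
  by apply: ler_pM; [lra|lra|lra|rewrite lerD2r ler_wpM2r].
lra.
Qed.

(** For [w = q_n / q_(n+1)] the last hypothesis is [|q_n| <= q < |q_(n+1)|] divided by [|q_(n+1)|].
    Up to a common sign of [u] and [v], [v >= 1]; then [v + u w < 1] forces [u w < 0], and the sign
    of [w] selects one of the two previous bounds. The constants 2/5 and 31/50 are rational upper
    bounds of [2 - phi] and [phi - 1]. *)
Lemma intermediate_bound (R : realFieldType) (w X : R) (u v : int) :
  2 <= X -> - (2 / 5) <= w <= 31 / 50 -> v != 0 ->
  `|w| <= `|v%:~R + u%:~R * w| < 1 ->
  X + w < 3 * `|(v%:~R + u%:~R * w) * (v%:~R - u%:~R * X)|.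
Proof.
wlog v_gt0 : u v / 0 < v => [wl|] X2 /andP[w_ge w_le] v0 /andP[h1 h2].
  have [v_lt0|v_ge0] := ltP v 0; last first.
    by apply: wl; rewrite ?h1 ?w_ge// lt_neqAle eq_sym v0.
  have vN : `|(- v)%:~R + (- u)%:~R * w| = `|v%:~R + u%:~R * w|.
    by rewrite -normrN; congr `|_|; rewrite !rmorphN /=; ring.
  have := wl (- u) (- v); rewrite oppr_gt0 oppr_eq0 vN w_ge w_le h1 h2.
  move=> /(_ v_lt0 X2 isT v0 isT); congr (_ < 3 * `|_|).
  by rewrite !rmorphN /=; ring.
have int12 (k : int) : 0 < k -> (k%:~R = 1 :> R) \/ (2 <= k%:~R :> R).
  move=> k0; have [->|k2] : k = 1 \/ 2 <= k by lia.
    by left.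
  by right; rewrite -[2]/(2%:~R) ler_int.
have v1 : 1 <= v%:~R :> R by case: (int12 _ v_gt0) => ?; lra.
have vuw : v%:~R + u%:~R * w < 1 by exact: le_lt_trans (ler_norm _) h2.
rewrite normrM; have [w0|w0|w0] := ltgtP w 0; last first.
- by move: vuw; rewrite w0; lra.
- have u0 : 0 < - u.
    have : u%:~R * w < 0 by lra.
    by rewrite pmulr_llt0// ltrz0; lia.
  have e : v%:~R + u%:~R * w = v%:~R - (- u)%:~R * w.
    by rewrite rmorphN /=; ring.
  have := @opposite_side_bound _ w X (- u)%:~R v%:~R X2 _ (int12 _ u0)
    (int12 _ v_gt0).
  rewrite -e w0 w_le h2 => /(_ isT) h.
  apply: lt_le_trans (h _) _; first by rewrite (le_trans _ h1) ?ler_norm.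
  rewrite ler_pM2l// ler_wpM2l// (le_trans _ (ler_norm _))//.
  by rewrite rmorphN /=; lra.
- have u0 : 0 < u.
    have : u%:~R * w < 0 by lra.
    by rewrite nmulr_llt0// ltr0z.
  have e : v%:~R + u%:~R * w = v%:~R - u%:~R * (- w) by ring.
  have := @same_side_bound _ (- w) X u%:~R v%:~R X2 _ (int12 _ u0)
    (int12 _ v_gt0).
  rewrite -e oppr_gt0 w0 lerNl w_ge h2 opprK => /(_ isT) h.
  apply: lt_le_trans (h _) _.
    by rewrite (le_trans _ h1)// -normrN ler_norm.
  rewrite ler_pM2l// ler_wpM2l//.
  by rewrite -normrN (le_trans _ (ler_norm _))// opprB.
Qed.

(** * Nearest integers *)

Section NearestInt.
Variable R : realType.
Implicit Types (x y : R).

Lemma nearest_int_dist y : `|y - (nearest_int y)%:~R| <= 2^-1.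
Proof.
have /andP[l1] := floor_itv y; rewrite intrD => l2.
rewrite /nearest_int; case: (leP (y - _)) => h; first by rewrite ger0_norm; lra.
by rewrite intrD ler_norml; apply/andP; split; lra.
Qed.

Lemma nearest_int_ge (k : int) y : k%:~R <= y -> k <= nearest_int y.
Proof.
move=> ky; have : k <= Num.floor y by rewrite floor_ge_int.
by rewrite /nearest_int; case: ifP => _; lia.
Qed.

Lemma nearest_int_le (k : int) y : y <= k%:~R -> nearest_int y <= k.
Proof.
move=> yk; rewrite leNgt; apply/negP => h.
have : (k + 1)%:~R <= (nearest_int y)%:~R :> R by rewrite ler_int; lia.
rewrite intrD => h'.
have [+ _] := nearest_intP y k.
rewrite !ler0_norm; lra.
Qed.

Lemma irrational_inv_sub y (b : int) :
  irrational y -> irrational (y - b%:~R)^-1.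
Proof.
move=> yirr [r _ r_eq]; apply: yirr; exists (r^-1 + b%:~R) => //.
by rewrite rmorphD /= ratr_int fmorphV /= r_eq invrK subrK.
Qed.

End NearestInt.

(** Changing the signs of [w], [X] and [u] together preserves both factors, which reduces the claim
    to positive [X]. *)
Lemma intermediate_bound_sg (R : realFieldType) (w X : R) (u v : int) :
  2 <= `|X| -> - (2 / 5) <= Num.sg X * w <= 31 / 50 -> v != 0 ->
  `|w| <= `|v%:~R + u%:~R * w| < 1 ->
  `|X + w| < 3 * `|(v%:~R + u%:~R * w) * (v%:~R - u%:~R * X)|.
Proof.
move=> X2 wb v0 h; have [X0|X0] := leP 0 X.
  have X_gt0 : 0 < X by move: X2; rewrite ger0_norm//; lra.
  move: X2 wb; rewrite gtr0_sg// mul1r ger0_norm// => X2 wb.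
  have := @intermediate_bound _ w X u v X2 wb v0 h.
  by case/andP: wb => *; rewrite [ltLHS]ger0_norm//; lra.
move: X2 wb; rewrite ltr0_sg// mulN1r (ler0_norm (ltW X0)) => X2 wb.
have eN (t : R) : (- u)%:~R * - t = u%:~R * t by rewrite rmorphN /= mulrNN.
have := @intermediate_bound _ (- w) (- X) (- u) v X2 wb v0.
rewrite !eN normrN => /(_ h).
by case/andP: wb => *; rewrite [ltLHS]ler0_norm ?opprD//; lra.
Qed.

(** * The golden ratio *)

Section GoldenRatio.
Variable R : realType.
Local Notation phi := (@golden_ratio R).

Lemma golden_ratio_sqr : phi ^+ 2 = phi + 1.
Proof.
have : Num.sqrt 5 ^+ 2 = 5 :> R by rewrite sqr_sqrtr.
by rewrite /golden_ratio; lra.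
Qed.

Lemma golden_ratio_itv : 8 / 5 < phi < 81 / 50.
Proof.
have s0 : 0 <= Num.sqrt 5 :> R by exact: sqrtr_ge0.
have s5 : Num.sqrt 5 ^+ 2 = 5 :> R by rewrite sqr_sqrtr.
by rewrite /golden_ratio; apply/andP; split; nra.
Qed.

Lemma golden_ratioV : phi^-1 = phi - 1.
Proof.
have /andP[? _] := golden_ratio_itv; have := golden_ratio_sqr => e.
have p0 : phi != 0 by rewrite gt_eqF//; lra.
by apply: (mulfI p0); rewrite divff//; lra.
Qed.

Lemma golden_ratio1V : (phi + 1)^-1 = 2 - phi.
Proof.
have /andP[? _] := golden_ratio_itv; have := golden_ratio_sqr => e.
have p0 : phi + 1 != 0 by rewrite gt_eqF//; lra.
by apply: (mulfI p0); rewrite divff//; lra.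
Qed.

End GoldenRatio.

(** * Convergents of an integer sequence *)

(* The indices are shifted by one with respect to the usual convention, so that
   the initial values [p_(-1) / q_(-1) = 1 / 0] have index [0]: the [n]-th
   convergent is [convergent_num a n.+1 / convergent_den a n.+1]. *)
Fixpoint convergent_num (a : nat -> int) n : int :=
  if n is m.+1 then
    if m is k.+1 then a m * convergent_num a m + convergent_num a k else a 0%N
  else 1.

Fixpoint convergent_den (a : nat -> int) n : int :=
  if n is m.+1 then
    if m is k.+1 then a m * convergent_den a m + convergent_den a k else 1
  else 0.

Lemma convergent_numSS (a : nat -> int) n :
  convergent_num a n.+2 =
  a n.+1 * convergent_num a n.+1 + convergent_num a n.
Proof. by []. Qed.

Lemma convergent_denSS (a : nat -> int) n :
  convergent_den a n.+2 =
  a n.+1 * convergent_den a n.+1 + convergent_den a n.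
Proof. by []. Qed.

Lemma convergent_det (a : nat -> int) n :
  convergent_num a n.+1 * convergent_den a n -
  convergent_num a n * convergent_den a n.+1 = (-1) ^+ n.+1.
Proof.
elim: n => [|n IHn]; first by rewrite /= mulr0 sub0r mulr1.
rewrite convergent_numSS convergent_denSS exprS -IHn; ring.
Qed.

(** * Complete and partial quotients of the Hurwitz expansion *)

Section Hurwitz.
Variables (R : realType) (x : R).
Hypothesis x_irrational : irrational x.

Local Notation X := (hurwitz_x x).
Local Notation a := (hurwitz_a x).
Local Notation P := (convergent_num a).
Local Notation Q := (convergent_den a).
Local Notation phi := (@golden_ratio R).

Lemma hurwitz_xS n : X n.+1 = (X n - (a n)%:~R)^-1.
Proof. by []. Qed.

Lemma hurwitz_x_irrational n : irrational (X n).
Proof. by elim: n => // n IHn; exact: irrational_inv_sub. Qed.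

Lemma hurwitz_x_neq n : X n - (a n)%:~R != 0.
Proof.
rewrite subr_eq0; apply/eqP => e; apply: (@hurwitz_x_irrational n).
by exists (a n)%:~R => //; rewrite e ratr_int.
Qed.

Lemma hurwitz_x_ge2 n : 2 <= `|X n.+1|.
Proof.
rewrite hurwitz_xS normfV -[2]invrK lef_pV2 ?posrE ?invr_gt0//.
  exact: nearest_int_dist.
by rewrite normr_gt0 hurwitz_x_neq.
Qed.

Lemma hurwitz_x_neq0 n : X n.+1 != 0.
Proof. by rewrite -normr_gt0; have := hurwitz_x_ge2 n; lra. Qed.

(** Since [|X n.+1| >= 2], rounding cannot cross 2 or -2, so the partial quotient keeps the sign of
    the complete quotient. *)
Lemma hurwitz_a_norm n :
  `|a n.+1|%:~R = Num.sg (X n.+1) * (a n.+1)%:~R :> R /\ 2 <= `|a n.+1|.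
Proof.
have := hurwitz_x_ge2 n; have [X0|X0] := leP 0 (X n.+1).
  rewrite ger0_norm// => X2; have a2 : 2 <= a n.+1 by apply: nearest_int_ge.
  rewrite gtr0_sg ?mul1r; last by lra.
  by rewrite ger0_norm; [split|lia].
rewrite ltr0_norm// => X2; have a2 : a n.+1 <= - 2.
  by apply: nearest_int_le; rewrite rmorphN lerNr.
rewrite ltr0_sg// mulN1r ler0_norm; last by lia.
by rewrite rmorphN; split=> //; lia.
Qed.

Lemma hurwitz_a_ge2 n : 2 <= `|a n.+1|%:~R :> R.
Proof. by rewrite -[2]/(2%:~R) ler_int; case: (hurwitz_a_norm n). Qed.

Lemma hurwitz_sg_mul n : Num.sg (X n.+1) * Num.sg (X n.+1) = 1.
Proof. by rewrite -expr2 sqr_sg hurwitz_x_neq0. Qed.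

(** Here [|X n.+1| >= 2 = |a n.+1|], so the nonzero remainder [X n.+1 - a n.+1] has the sign of
    [X n.+1], and inversion keeps it. *)
Lemma hurwitz_sg_next n :
  `|a n.+1| = 2 -> Num.sg (X n.+2) = Num.sg (X n.+1).
Proof.
have [aE _] := hurwitz_a_norm n => a2.
rewrite hurwitz_xS sgrV; set y := X n.+1 - _.
have sy : 0 < Num.sg (X n.+1) * y.
  rewrite lt_neqAle eq_sym mulf_neq0 ?hurwitz_x_neq ?sgr_eq0 ?hurwitz_x_neq0//=.
  by rewrite mulrBr -aE a2 -normrEsg subr_ge0 hurwitz_x_ge2.
by move/gtr0_sg: sy; rewrite sgrM sgr_id => e;
  rewrite -[LHS]mul1r -(hurwitz_sg_mul n) -mulrA e mulr1.
Qed.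

(** * Ratios of consecutive denominators *)

Definition den_ratio n : R := (Q n)%:~R / (Q n.+1)%:~R.
Local Notation v := den_ratio.

Lemma den_ratio_bound n :
  Q n.+1 != 0 /\ - (2 - phi) <= Num.sg (X n.+1) * v n <= phi - 1.
Proof.
have /andP[phi_gt phi_lt] := golden_ratio_itv R.
elim: n => [|n [Q0 /andP[v_ge v_le]]].
  by split=> //; rewrite /den_ratio mul0r mulr0; apply/andP; split; lra.
have [aE a2] := hurwitz_a_norm n.
set s := Num.sg (X n.+1) in v_ge v_le aE *.
have ss : s * s = 1 := hurwitz_sg_mul n.
have Q0R : (Q n.+1)%:~R != 0 :> R by rewrite intr_eq0.
pose D : R := (a n.+1)%:~R + v n.
have sD : s * D = `|a n.+1|%:~R + s * v n by rewrite mulrDr -aE.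
have QD : (Q n.+2)%:~R = (Q n.+1)%:~R * D.
  rewrite convergent_denSS intrD intrM /D mulrDr mulrC; congr (_ + _).
  by rewrite mulrCA divff// mulr1.
have a2R := hurwitz_a_ge2 n.
have sD0 : 0 < s * D by lra.
have D0 : D != 0 by apply: contraTneq sD0 => ->; rewrite mulr0 ltxx.
have vD : v n.+1 = D^-1.
  by rewrite /den_ratio QD invfM mulrA divff// mul1r.
split; first by rewrite -(intr_eq0 R) QD mulf_neq0.
have sV : s * D^-1 = (s * D)^-1.
  apply: (mulIf (lt0r_neq0 sD0)); rewrite mulVf ?lt0r_neq0//.
  by rewrite mulrACA ss mul1r mulVf.
(* The lower bound of [s * D] is [2 - (2 - phi) = phi] or [3 - (2 - phi) = phi + 1]; the inverses
   [phi - 1] and [2 - phi] are the ends of the interval. *)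
rewrite vD; have [a_eq2|a_ge3] : `|a n.+1| = 2 \/ 3 <= `|a n.+1| by lia.
  rewrite hurwitz_sg_next// -/s sV; apply/andP; split.
    by rewrite (@le_trans _ _ 0) ?invr_ge0 ?ltW//; lra.
  by rewrite -golden_ratioV lef_pV2 ?posrE//; lra.
have a3R : 3 <= `|a n.+1|%:~R :> R by rewrite -[3]/(3%:~R) ler_int.
(* The next sign is now arbitrary, but [2 - phi < phi - 1], so a bound on the modulus fits both
   ends. *)
have : `|Num.sg (X n.+2) * D^-1| <= 2 - phi.
  rewrite normrM normr_sg hurwitz_x_neq0 mul1r.
  have -> : `|D^-1| = (s * D)^-1.
    rewrite -sV -[RHS]gtr0_norm; last by rewrite sV invr_gt0.
    by rewrite normrM normr_sg hurwitz_x_neq0 mul1r.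
  by rewrite -golden_ratio1V lef_pV2 ?posrE//; lra.
by rewrite ler_norml => /andP[? ?]; apply/andP; split; lra.
Qed.

Lemma convergent_den_neq0 n : Q n.+1 != 0.
Proof. by case: (den_ratio_bound n). Qed.

Lemma convergent_den_step n :
  (`|a n.+1|%:~R - (2 - phi)) * `|Q n.+1|%:~R <= `|Q n.+2|%:~R
    <= (`|a n.+1|%:~R + (phi - 1)) * `|Q n.+1|%:~R.
Proof.
have [Q0 /andP[v_ge v_le]] := den_ratio_bound n.
have [aE a2] := hurwitz_a_norm n.
set s := Num.sg (X n.+1) in v_ge v_le aE *.
have /andP[phi_gt phi_lt] := golden_ratio_itv R.
have a2R := hurwitz_a_ge2 n.
have -> : `|Q n.+2|%:~R = (`|a n.+1|%:~R + s * v n) * `|Q n.+1|%:~R :> R.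
  rewrite -[_ + _]gtr0_norm; last by lra.
  rewrite aE -mulrDr !normrM normr_sg hurwitz_x_neq0 mul1r !intr_norm -normrM.
  congr `|_|; rewrite mulrDl /den_ratio divfK ?intr_eq0//.
  by rewrite convergent_denSS intrD intrM.
have Qge0 : 0 <= `|Q n.+1|%:~R :> R by rewrite ler0z.
by rewrite !ler_wpM2r//; lra.
Qed.

(** * Approximation errors of the convergents *)

Definition approx_error n : R := (Q n)%:~R * x - (P n)%:~R.
Local Notation th := approx_error.

(** The errors satisfy the recurrence of [P] and [Q], so by induction
    [th n.+2 = - (X n.+1 - a n.+1) * th n.+1], and [X n.+2] inverts the factor. *)
Lemma approx_errorS n : th n = - (X n.+1 * th n.+1).
Proof.
have XV k : X k.+1 * (X k - (a k)%:~R) = 1.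
  by rewrite hurwitz_xS mulVf// hurwitz_x_neq.
elim: n => [|n IHn].
  by rewrite /approx_error /= mul0r sub0r mul1r (XV 0%N).
have -> : th n.+2 = (a n.+1)%:~R * th n.+1 + th n.
  rewrite /approx_error convergent_denSS convergent_numSS !intrD !intrM; ring.
transitivity (X n.+2 * (X n.+1 - (a n.+1)%:~R) * th n.+1).
  by rewrite XV mul1r.
rewrite IHn; ring.
Qed.

(** By [approx_errorS] the product inside the norm is [Q n * th n.+1 - Q n.+1 * th n], in which [x]
    cancels and a determinant of modulus 1 remains. *)
Lemma approx_error_den n :
  `|(Q n.+1)%:~R * th n.+1| * `|X n.+1 + v n| = 1 :> R.
Proof.
have Q0R : (Q n.+1)%:~R != 0 :> R by rewrite intr_eq0 convergent_den_neq0.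
rewrite -normrM.
have -> : (Q n.+1)%:~R * th n.+1 * (X n.+1 + v n) = - ((-1) ^+ n.+1)%:~R :> R.
  rewrite -(convergent_det a n) rmorphB /= !rmorphM /= mulrDr.
  have -> : (Q n.+1)%:~R * th n.+1 * X n.+1 = - (Q n.+1)%:~R * th n.
    by rewrite [th n]approx_errorS; ring.
  have -> : (Q n.+1)%:~R * th n.+1 * v n = (Q n)%:~R * th n.+1.
    by rewrite /den_ratio mulrAC mulrCA divff// mulr1.
  rewrite /approx_error; ring.
by rewrite rmorphXn /= rmorphN /= normrN normrX normrN1 expr1n.
Qed.

Lemma coprime_convergent n : gcdz (P n.+1) (Q n.+1) = 1.
Proof.
apply/eqP; apply/coprimezP.
exists ((-1) ^+ n.+1 * Q n, - (-1) ^+ n.+1 * P n) => /=.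
transitivity ((-1) ^+ n.+1 * (P n.+1 * Q n - P n * Q n.+1) : int); first by ring.
by rewrite convergent_det -exprD addnn -mul2n exprM sqrrN expr1n.
Qed.

(** * Good approximations are convergents *)

Lemma legendre_hurwitz n (p q : int) :
  gcdz p q = 1 -> `|Q n.+1| <= q < `|Q n.+2| ->
  `|q%:~R * (q%:~R * x - p%:~R)| <= 1 / 3 ->
  p = Num.sg (Q n.+1) * P n.+1 /\ q = `|Q n.+1|.
Proof.
move=> pq1 /andP[q_ge q_lt] pq_le.
pose e : int := (-1) ^+ n.+2.
have ee : e * e = 1 by rewrite -exprD addnn -mul2n exprM sqrrN expr1n.
have [u [k [pE qE]]] : exists u k : int,
    p = u * P n.+1 + k * P n.+2 /\ q = u * Q n.+1 + k * Q n.+2.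
  (* Cramer's rule; the determinant [e] is its own inverse, so the coordinates are integers. *)
  exists (e * (q * P n.+2 - p * Q n.+2)), (e * (p * Q n.+1 - q * P n.+1)).
  have det (t : int) : t = e * (P n.+2 * Q n.+1 - P n.+1 * Q n.+2) * t.
    by rewrite convergent_det ee mul1r.
  by split; rewrite [LHS]det; ring.
have Q0 := convergent_den_neq0 n; have Q1 := convergent_den_neq0 n.+1.
have [k0|k0] := eqVneq k 0.
  rewrite k0 !mul0r !addr0 in pE qE.
  have u1 : `|u|%N = 1%N.
    by move: pq1; rewrite pE qE -mulz_gcdr coprime_convergent mulr1 => -[].
  have [u_eq|u_eq] : u = 1 \/ u = -1 by lia.
    rewrite u_eq !mul1r in pE qE.
    have : 0 < Q n.+1 by lia.
    by move=> Q_gt0; rewrite gtr0_sg// mul1r gtr0_norm.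
  rewrite u_eq !mulN1r in pE qE.
  have : Q n.+1 < 0 by lia.
  by move=> Q_lt0; rewrite ltr0_sg// mulN1r ltr0_norm.
have Q1R : (Q n.+2)%:~R != 0 :> R by rewrite intr_eq0.
have Q1_gt0 : 0 < `|(Q n.+2)%:~R| :> R by rewrite normr_gt0.
pose w := v n.+1.
have qw : q%:~R = (Q n.+2)%:~R * (k%:~R + u%:~R * w).
  rewrite qE intrD !intrM /w /den_ratio mulrDr [_ * k%:~R]mulrC addrC.
  by congr (_ + _); rewrite mulrCA [_ * (_ / _)]mulrCA divff// mulr1.
have thw : q%:~R * x - p%:~R = th n.+2 * (k%:~R - u%:~R * X n.+2).
  transitivity (u%:~R * th n.+1 + k%:~R * th n.+2).
    by rewrite qE pE !intrD !intrM /approx_error; ring.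
  by rewrite [th n.+1]approx_errorS; ring.
have [_ /andP[v_ge v_le]] := den_ratio_bound n.+1.
have /andP[phi_gt phi_lt] := golden_ratio_itv R.
have q_gt0 : 0 < q by lia.
have kuw : `|k%:~R + u%:~R * w| = q%:~R / `|(Q n.+2)%:~R|.
  have q_gt0R : 0 < q%:~R :> R by rewrite ltr0z.
  by rewrite -[q%:~R in RHS]gtr0_norm// qw normrM mulrAC divff ?gt_eqF// mul1r.
have := @intermediate_bound_sg _ w (X n.+2) u k (hurwitz_x_ge2 n.+1) _ k0.
have -> : - (2 / 5) <= Num.sg (X n.+2) * w <= 31 / 50.
  by rewrite /w; apply/andP; split; lra.
have -> : `|w| <= `|k%:~R + u%:~R * w| < 1.
  rewrite kuw ltr_pdivrMr// mul1r /w /den_ratio normrM normfV ler_pM2r ?invr_gt0//.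
  by rewrite -!intr_norm ler_int ltr_int q_ge.
move=> /(_ isT isT); have := approx_error_den n.+1; rewrite -/w.
move: pq_le; rewrite thw {1}qw mulrACA normrM.
set A := `|_ * th _|; set B := `|_ * (_ - _)|; set C := `|_ + w| => AB AC CB.
(* Multiplying [A * B <= 1 / 3] by [C] and using [A * C = 1] gives [3 * B <= C], against
   [C < 3 * B]. *)
have : C * (A * B) <= C * (1 / 3) by apply: ler_wpM2l => //; exact: normr_ge0.
have -> : C * (A * B) = B by rewrite mulrA [C * A]mulrC AC mul1r.
rewrite mulrCA mul1r ler_pdivlMr// mulrC => BC.
by have := lt_le_trans CB BC; rewrite ltxx.
Qed.

(** * Thresholds on the partial quotients *)

(** Up to sign, [X n.+1 + v n] is [|a n.+1|] plus a rounding error of at most 1/2 plus a term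
    between [- (2 - phi)] and [phi - 1]. *)
Lemma approx_error_itv n :
  `|a n.+1|%:~R - (5 / 2 - phi) <= `|X n.+1 + v n|
    <= `|a n.+1|%:~R + (phi - 1 / 2).
Proof.
have [_ /andP[v_ge v_le]] := den_ratio_bound n.
have [aE _] := hurwitz_a_norm n.
have a2 := hurwitz_a_ge2 n.
have /andP[phi_gt phi_lt] := golden_ratio_itv R.
set s := Num.sg (X n.+1) in v_ge v_le aE.
have : `|s * (X n.+1 - (a n.+1)%:~R)| <= 2^-1.
  by rewrite normrM normr_sg hurwitz_x_neq0 mul1r nearest_int_dist.
rewrite ler_norml mulrBr -aE => /andP[d_ge d_le].
have -> : `|X n.+1 + v n| = s * X n.+1 + s * v n.
  rewrite -[RHS]ger0_norm -?mulrDr; last by rewrite mulrDr; lra.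
  by rewrite normrM normr_sg hurwitz_x_neq0 mul1r.
by apply/andP; split; lra.
Qed.

Lemma approx_errorE n :
  `|(Q n.+1)%:~R * th n.+1| = `|X n.+1 + v n|^-1.
Proof.
have e := approx_error_den n.
have X0 : `|X n.+1 + v n| != 0.
  by apply/eqP => X0; move/eqP: e; rewrite X0 mulr0 eq_sym oner_eq0.
by apply: (mulIf X0); rewrite e mulVf.
Qed.

Lemma approx_error_le n delta : 0 < delta ->
  delta^-1 + (5 / 2 - phi) <= `|a n.+1|%:~R ->
  `|(Q n.+1)%:~R * th n.+1| <= delta.
Proof.
move=> delta0 h; have /andP[X_ge _] := approx_error_itv n.
have dX : delta^-1 <= `|X n.+1 + v n| by lra.
have dV : 0 < delta^-1 by rewrite invr_gt0.
rewrite approx_errorE -[delta]invrK lef_pV2// posrE//.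
exact: lt_le_trans dX.
Qed.

Lemma hurwitz_a_ge n delta : 0 < delta ->
  `|(Q n.+1)%:~R * th n.+1| <= delta ->
  delta^-1 - (phi - 1 / 2) <= `|a n.+1|%:~R.
Proof.
move=> delta0; have /andP[_ X_le] := approx_error_itv n.
have X0 : 0 < `|X n.+1 + v n|.
  rewrite lt_neqAle normr_ge0 andbT; apply/eqP => X0.
  by move/eqP: (approx_error_den n); rewrite -X0 mulr0 eq_sym oner_eq0.
rewrite approx_errorE -[leRHS]invrK lef_pV2 ?posrE ?invr_gt0//.
lra.
Qed.

(** * Growth of the denominators and counting of approximations *)

Lemma convergent_den_lt n : `|Q n.+1| < `|Q n.+2|.
Proof.
have /andP[+ _] := convergent_den_step n.
have a2 := hurwitz_a_ge2 n.
have /andP[phi_gt phi_lt] := golden_ratio_itv R.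
have Q0 : 0 < `|Q n.+1|%:~R :> R by rewrite ltr0z normr_gt0 convergent_den_neq0.
by rewrite -(ltr_int R); apply: lt_le_trans; rewrite ltr_pMl//; lra.
Qed.

Lemma convergent_den_ge n : n.+1%:Z <= `|Q n.+1|.
Proof. by elim: n => // n; have := convergent_den_lt n; lia. Qed.

Lemma locate_den N m (r : R) :
  `|Q N.+1|%:~R <= r < `|Q (N + m).+2|%:~R ->
  exists2 n, (N <= n <= N + m)%N & `|Q n.+1|%:~R <= r < `|Q n.+2|%:~R.
Proof.
elim: m => [|m IHm] /andP[r_ge r_lt].
  rewrite addn0 in r_lt *; exists N; first by rewrite leqnn.
  by rewrite r_ge.
have [r_lt'|r_ge'] := ltP r `|Q (N + m).+2|%:~R; last first.
  by exists (N + m.+1)%N; rewrite ?leq_addr//= r_lt andbT addnS.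
have [|n /andP[Nn nm] h] := IHm; first by rewrite r_ge.
by exists n => //; rewrite Nn addnS leqW.
Qed.

(** Hurwitz denominators may be negative; the sign factor selects the representative with positive
    denominator. *)
Definition convergent_pair n : int * int :=
  (Num.sg (Q n.+1) * P n.+1, `|Q n.+1|).

Lemma convergent_pair_inj : injective convergent_pair.
Proof.
move=> i j /(congr1 snd) /=; apply: (@increasing_seq_injective _ _ (fun n => `|Q n.+1|)).
by apply/increasing_seqP => n; exact: convergent_den_lt.
Qed.

Lemma convergent_pair_error n (p := (convergent_pair n).1)
    (q := (convergent_pair n).2) :
  `|q%:~R * (q%:~R * x - p%:~R)| = `|(Q n.+1)%:~R * th n.+1|.
Proof.
have sg2 : Num.sg (Q n.+1)%:~R ^+ 2 = 1 :> R.
  by rewrite sqr_sg intr_eq0 convergent_den_neq0.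
rewrite /p /q /= intr_norm (normrEsg (Q n.+1)%:~R) intrM intr_sg.
transitivity `|Num.sg (Q n.+1)%:~R ^+ 2 * ((Q n.+1)%:~R * th n.+1)|.
  by congr `|_|; rewrite /approx_error; ring.
by rewrite sg2 mul1r.
Qed.

Definition good_convergent delta n := `|(Q n.+1)%:~R * th n.+1| <= delta.

Lemma card_approximations n delta rho : delta <= 1 / 3 ->
  `|Q n.+1|%:~R <= rho < `|Q n.+2|%:~R ->
  #|` fset_set (approximations x delta rho)| =
  count (good_convergent delta) (iota 0 n.+1).
Proof.
move=> delta_le /andP[rho_ge rho_lt].
pose s := [seq convergent_pair j | j <- iota 0 n.+1 & good_convergent delta j].
have -> : approximations x delta rho = [set` [fset z in s]%fset].
  apply/seteqP; split=> [[p q] /= [pq1 q0 q_rho pq_le]|[p q]] /=; last first.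
    rewrite inE => /mapP[j]; rewrite mem_filter mem_iota add0n.
    move=> /andP[jgood /= jn] [-> ->]; have Q0 := convergent_den_neq0 j.
    split => /=.
    - apply: etrans (coprime_convergent j).
      by rewrite /gcdz abszM absz_sg Q0 mul1n absz_id.
    - by rewrite normr_gt0.
    - apply: le_trans rho_ge; rewrite ler_int.
      have /increasing_seqP inc : forall i, `|Q i.+1| < `|Q i.+2|.
        exact: convergent_den_lt.
      by rewrite inc -ltnS.
    - by rewrite (convergent_pair_error j).
  (* The search can start at index 0 because [Q 1 = 1 <= q]. *)
  have [] := @locate_den 0%N n q%:~R.
    rewrite add0n (le_lt_trans q_rho rho_lt) andbT.
    by rewrite ler_int (_ : `|Q 1| = 1)//; lia.
  move=> j /andP[_ jn]; rewrite ler_int ltr_int => qQ.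
  have [pE qE] := legendre_hurwitz j p q pq1 qQ (le_trans pq_le delta_le).
  rewrite inE; apply/mapP; exists j; last by rewrite pE qE.
  rewrite mem_filter mem_iota add0n ltnS jn leq0n !andbT.
  by move: pq_le; rewrite pE qE (convergent_pair_error j).
rewrite set_fsetK card_fseq undup_id ?size_map ?size_filter//.
by rewrite map_inj_uniq ?filter_uniq ?iota_uniq//; exact: convergent_pair_inj.
Qed.

(** * Sums of logarithms *)

Lemma ln_convergent_den n :
  \sum_(1 <= j < n.+1) ln (`|a j|%:~R + - (2 - phi)) <= ln `|Q n.+1|%:~R
    <= \sum_(1 <= j < n.+1) ln (`|a j|%:~R + (phi - 1)).
Proof.
have /andP[phi_gt phi_lt] := golden_ratio_itv R.
elim: n => [|n /andP[IH1 IH2]].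
  by rewrite !big_geq// (_ : `|Q 1| = 1)// ln1 lexx.
have a2 := hurwitz_a_ge2 n.
have Qpos k : 0 < `|Q k.+1|%:~R :> R.
  by rewrite ltr0z normr_gt0 convergent_den_neq0.
have /andP[step1 step2] := convergent_den_step n.
rewrite !(@big_nat_recr _ _ _ n.+1)//; apply/andP; split.
  apply: le_trans (lerD IH1 (lexx _)) _.
  rewrite -lnM ?posrE//; last by lra.
  by rewrite mulrC ler_ln ?posrE// mulr_gt0//; lra.
apply: le_trans (lerD IH2 (lexx _)).
rewrite -lnM ?posrE//; last by lra.
by rewrite mulrC ler_ln ?posrE// mulr_gt0//; lra.
Qed.

(** Each argument of the logarithm is at least [2 + (phi - 2) = phi]. *)
Lemma sum_ln_ge d n : phi - 2 <= d ->
  ln phi * n%:R <= \sum_(1 <= j < n.+1) ln (`|a j|%:~R + d).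
Proof.
have /andP[phi_gt phi_lt] := golden_ratio_itv R => d_ge.
rewrite mulr_natr -[n in leLHS](subn1 n.+1) -sumr_const_nat ler_sum_nat//.
case=> // j _; have a2 := hurwitz_a_ge2 j.
by rewrite ler_ln ?posrE; lra.
Qed.

Lemma ln_golden_gt0 : 0 < ln phi.
Proof. by have /andP[? _] := golden_ratio_itv R; rewrite ln_gt0//; lra. Qed.

(** The factor 2 absorbs the shift in [harmonic n = 1 / (n + 1)], as [n + 1 <= 2 n]. *)
Lemma inv_sum_ln_le d n : phi - 2 <= d -> (0 < n)%N ->
  (\sum_(1 <= j < n.+1) ln (`|a j|%:~R + d))^-1
    <= 2 / ln phi * harmonic n.
Proof.
move=> d_ge n0; have c0 := ln_golden_gt0.
have cn : 0 < ln phi * n%:R by rewrite mulr_gt0// ltr0n.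
have S_ge := sum_ln_ge d n d_ge.
rewrite -[X in _ <= X * _]invrK -invfM lef_pV2 ?posrE; last 2 first.
- exact: lt_le_trans S_ge.
- by rewrite mulr_gt0 ?ltr0n// invr_gt0 divr_gt0.
apply: le_trans S_ge; rewrite invfM invrK mulrAC mulrC ler_pM2l//.
rewrite mulrC ler_pdivrMr// -natrM ler_nat; lia.
Qed.

Lemma cvg_scaled_harmonic : 2 / ln phi * harmonic n @[n --> \oo] --> (0 : R).
Proof.
rewrite -[0 in X in _ --> X](mulr0 (2 / ln phi)).
by apply: cvgM; [exact: cvg_cst|exact: cvg_harmonic].
Qed.

Lemma near_locate_den N :
  \forall r \near (pinfty_nbhs R), exists2 n, (N <= n)%N &
    `|Q n.+1|%:~R <= r < `|Q n.+2|%:~R.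
Proof.
near=> r.
have r_ge : `|Q N.+1|%:~R <= r by near: r; apply: nbhs_pinfty_ge; exact: num_real.
have [|n /andP[Nn _] h] := @locate_den N (Num.truncn r) r; last by exists n.
rewrite r_ge andTb; have := truncnS_gt r; move/lt_le_trans; apply.
rewrite pmulrn ler_int; apply: le_trans (convergent_den_ge _).
by rewrite lez_nat ltnS leqW ?leq_addl.
Unshelve. all: by end_near.
Qed.

(** * Comparison of the ratios and of their limits *)

Lemma approximation_ratio_le n delta rho : 0 < delta -> delta <= 1 / 3 ->
  (0 < n)%N -> `|Q n.+1|%:~R <= rho < `|Q n.+2|%:~R ->
  approximation_ratio x delta rho <=
    quotient_ratio a (delta^-1 - (phi - 1 / 2)) (- (2 - phi)) n +
    2 / ln phi * harmonic n.
Proof.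
move=> delta0 delta_le n0 rho_itv.
have /andP[rho_ge _] := rho_itv; have /andP[S_le _] := ln_convergent_den n.
have Qpos : 0 < `|Q n.+1|%:~R :> R.
  by rewrite ltr0z normr_gt0 convergent_den_neq0.
have d_ge : phi - 2 <= - (2 - phi) by lra.
rewrite /approximation_ratio (card_approximations n)// /quotient_ratio.
set S := \sum_(_ <= _ < _) _ in S_le *.
have S0 : 0 < S.
  apply: lt_le_trans (sum_ln_ge _ n d_ge).
  by rewrite mulr_gt0 ?ln_golden_gt0// ltr0n.
have S_rho : S <= ln rho.
  by rewrite (le_trans S_le)// ler_ln// posrE (lt_le_trans Qpos).
apply: le_trans (lerD (lexx _) (inv_sum_ln_le _ n d_ge n0)); rewrite -/S.
rewrite -[X in _ + X]mul1r -mulrDl; apply: ler_pM => //.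
- by rewrite invr_ge0 (le_trans (ltW S0)).
(* The convergent of index 0 lies outside the count of quotients; it costs the additional
   [1 / S]. *)
- rewrite natr1 ler_nat -[leqRHS]add1n leq_add// ?leq_b1//.
  by apply: sub_count => j; exact: hurwitz_a_ge.
- by rewrite lef_pV2 ?posrE// (lt_le_trans S0).
Qed.

(** The quotients are taken up to [n.+1] because [rho] is bounded above by [|Q n.+2|], whose
    logarithm the sum up to [n.+1] dominates. The surplus index [n.+1] in the count costs one
    term. *)
Lemma approximation_ratio_ge n delta rho : 0 < delta -> delta <= 1 / 3 ->
  (0 < n)%N -> `|Q n.+1|%:~R <= rho < `|Q n.+2|%:~R ->
  quotient_ratio a (delta^-1 + (5 / 2 - phi)) (phi - 1) n.+1 <=
    approximation_ratio x delta rho + 2 / ln phi * harmonic n.+1.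
Proof.
move=> delta0 delta_le n0 rho_itv.
have /andP[rho_ge rho_lt] := rho_itv.
have /andP[_ S_ge] := ln_convergent_den n.+1.
have rho1 : 1 < rho.
  apply: lt_le_trans rho_ge; rewrite -[1]/(1%:~R) ltr_int.
  by apply: lt_le_trans (convergent_den_ge _); lia.
have d_ge : phi - 2 <= phi - 1 by lra.
rewrite /approximation_ratio (card_approximations n)// /quotient_ratio.
set S := \sum_(_ <= _ < _) _ in S_ge *.
have rho_S : ln rho <= S.
  apply: le_trans S_ge; rewrite ler_ln ?posrE ?ltW//; first by lra.
  by apply: lt_trans rho_lt; lra.
have lnrho0 : 0 < ln rho by exact: ln_gt0.
have S0 : 0 < S by exact: lt_le_trans rho_S.
apply: le_trans (lerD (lexx _) (inv_sum_ln_le _ n.+1 d_ge isT)); rewrite -/S.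
set C := count _ _; set K := count _ _.
have CK : (C <= K + 1)%N.
  rewrite /C -[n.+1]addn1 iotaD count_cat leq_add//; last by rewrite /= addn0 leq_b1.
  rewrite /K /= (leq_trans _ (leq_addl _ _))//.
  by apply: sub_count => j; exact: approx_error_le.
apply: (@le_trans _ _ ((K + 1)%:R / S)).
  by rewrite ler_pM2r ?invr_gt0// ler_nat.
by rewrite natrD mulrDl mul1r lerD2r ler_wpM2l// lef_pV2 ?posrE.
Qed.

End Hurwitz.

Theorem theorem2 (R : realType) (x delta : R)
    (hx : irrational x) (delta_gt0 : 0 < delta) (delta_le : delta <= 1 / 3) :
  (limn_einf (fun n => (quotient_ratio (hurwitz_a x)
        (delta^-1 + (5 / 2 - golden_ratio)) (golden_ratio - 1) n)%:E)
     <= limf_einf (fun rho : R => (approximation_ratio x delta rho)%:E)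
          (pinfty_nbhs R))%E /\
  (limf_esup (fun rho : R => (approximation_ratio x delta rho)%:E)
     (pinfty_nbhs R)
     <= limn_esup (fun n => (quotient_ratio (hurwitz_a x)
        (delta^-1 - (golden_ratio - 1 / 2)) (- (2 - golden_ratio)) n)%:E))%E.
Proof.
split.
  apply: (limn_einf_le_limf_einf _ _ _ _ (cvg_scaled_harmonic R)) => N.
  (* Starting from [N.+1] ensures [n > 0]. *)
  apply: filterS (near_locate_den R x hx N.+1) => rho [n Nn rho_itv].
  exists n.+1; first exact: leqW (ltnW Nn).
  by apply: approximation_ratio_ge => //; exact: leq_ltn_trans Nn.
apply: (limf_esup_le_limn_esup _ _ _ _ (cvg_scaled_harmonic R)) => N.
apply: filterS (near_locate_den R x hx N.+1) => rho [n Nn rho_itv].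
exists n; first exact: ltnW.
by apply: approximation_ratio_le => //; exact: leq_ltn_trans Nn.
Qed.
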